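(* Let a (function-free, range-restricted) logic program $P$ and a database $D$ be given, where $P$ contains a goal rule with head $\mathit{answer}(X_1,\ldots,X_q)$. For every ground substitution $\theta$ such that $\theta(\mathit{answer}(X_1,\ldots,X_q))$ is a logical consequence of $P\cup D$, the fact $\theta(\mathit{answer}(X_1,\ldots,X_q))$ is computed, i.e. there is a state sequence $S_1,\ldots,S_n$ with $S_1$ the initial state and $\theta(\mathit{answer}(X_1,\ldots,X_q))\in S_n$.
   Context: Setting (function-free Datalog). A rule is a formula $A\leftarrow B_1\wedge\dots\wedge B_n$ with $A,B_i$ atoms $p(t_1,\ldots,t_m)$ whose terms are variables or constants (no function symbols); $A$ is the head, $B_1\wedge\dots\wedge B_n$ the body. A fact is a rule with empty body and no variables. Every rule is range restricted: each variable of the head occurs in the body. Predicates are partitioned into EDB predicates (defined by facts) and IDB predicates (defined by rules). A program is a finite set of rules, each with an IDB predicate in the head and at least one body literal; a database is a finite set of facts with EDB predicates. A distinguished IDB predicate $\mathit{answer}$ does not occur in any rule body; a rule with head predicate $\mathit{answer}$ is a goal rule (the query). Normalization: the variables of a rule, ordered by first occurrence, are renamed to $X_0,X_1,\ldots$ in that order. A state is a set of normalized rules. In every rule with nonempty body the selected literal is the leftmost body literal. Instantiation: if $K\leftarrow L_1\wedge\dots\wedge L_m$ ($m>0$) is a rule in the state and $R$ is a program rule, rename the variables of $R$ apart to get $R'=A'\leftarrow B'_1\wedge\dots\wedge B'_n$; if $L_1$ and $A'$ unify with most general unifier $\sigma$, then $\sigma(R')$ is an instance of $R$. Reduction: if $A\leftarrow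 B_1\wedge\dots\wedge B_n$ is a derived rule and $F$ is a fact (from the database or the state) such that $B_1$ and $F$ unify with mgu $\sigma$, then $\sigma(A\leftarrow B_2\wedge\dots\wedge B_n)$ is a reduct ($F$ reduces the rule). Derived rules are normalized before being added to a state. Initial state: the goal rule together with all rules obtainable from it iteratively by instantiation. Dependency: a rule $R$ depends directly on $R'$ iff the selected literal of $R$ unifies with the head of $R'$; $R$ depends on $R'$ with respect to a state $S$ iff there are $R_1,\ldots,R_n\in S$ with $R_1=R$, each $R_i$ depending directly on $R_{i+1}$, and $R_n$ depending directly on $R'$ ($R'$ need not be in $S$). Successor state: given $P$, $D$, a state $S$ and a fact $F\in D$, the successor $S'$ is built by: (1) initialize $S'$ with all reducts of rules in $S$ by $F$; if this is empty, there is no successor state; (2) if $S'$ contains IDB facts, repeatedly apply reduction to rules in $S$ with facts in $S'$, inserting the results into $S'$, until nothing changes; (3) iteratively apply instantiation to each rule of $S'$ whose selected literal is an IDB literal, adding all instances to $S'$; (4) copy into $S'$ every rule of $S$ that depends (with respect to $S$) on a rule of $S'$ having at least one body literal. A state sequence is $S_1,\ldots,S_n$ where each $S_{i+1}$ is the successor state of $S_i$ for some fact $F_i\in D$. *)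

(* Defs.v *)
(* MathComp *)
From HB Require Import structures.
From mathcomp Require Import all_boot.
Set Implicit Arguments.
Unset Strict Implicit.
Unset Printing Implicit Defensive.

(* The EDB predicates are those for which [idb] is false.  No arity is imposed:
   p(t_1,..,t_m) and p(t_1,..,t_k) with m <> k never unify and are interpreted
   independently, as if they had different predicates. *)
Record signature := Signature {
  const : eqType;
  predsym : eqType;
  idb : pred predsym;
  answer : predsym;
  answer_idb : idb answer
}.

Section Syntax.

Context {sg : signature}.

Inductive term := Var of nat | Cst of const sg.

Definition sum_of_term (t : term) : nat + const sg :=
  match t with Var x => inl x | Cst c => inr c end.
Definition term_of_sum (s : nat + const sg) : term :=
  match s with inl x => Var x | inr c => Cst c end.
Lemma sum_of_termK : cancel sum_of_term term_of_sum.
Proof. by case. Qed.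
HB.instance Definition _ := Equality.copy term (can_type sum_of_termK).

Record atom := Atom { apred : predsym sg; aargs : seq term }.

Definition pair_of_atom (A : atom) := (apred A, aargs A).
Definition atom_of_pair (p : predsym sg * seq term) := Atom p.1 p.2.
Lemma pair_of_atomK : cancel pair_of_atom atom_of_pair.
Proof. by case. Qed.
HB.instance Definition _ := Equality.copy atom (can_type pair_of_atomK).

Record rule := Rule { head : atom; body : seq atom }.

Definition pair_of_rule (R : rule) := (head R, body R).
Definition rule_of_pair (p : atom * seq atom) := Rule p.1 p.2.
Lemma pair_of_ruleK : cancel pair_of_rule rule_of_pair.
Proof. by case. Qed.
HB.instance Definition _ := Equality.copy rule (can_type pair_of_ruleK).

Definition is_const (t : term) : bool := if t is Cst _ then true else false.

Definition term_vars (t : term) : seq nat := if t is Var x then [:: x] else [::].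
Definition atom_vars (A : atom) : seq nat := flatten (map term_vars (aargs A)).
(* All variable occurrences, from left to right, with repetitions. *)
Definition rule_vars (R : rule) : seq nat :=
  atom_vars (head R) ++ flatten (map atom_vars (body R)).

Definition is_fact (R : rule) : bool := (body R == [::]) && (rule_vars R == [::]).

Definition range_restricted (R : rule) : bool :=
  all (fun x => x \in flatten (map atom_vars (body R))) (atom_vars (head R)).

Record is_program (P : seq rule) : Prop := IsProgram {
  program_range_restricted : forall R, R \in P -> range_restricted R;
  program_head_idb : forall R, R \in P -> idb (apred (head R));
  program_body : forall R, R \in P -> body R != [::];
  program_answer : forall R B, R \in P -> B \in body R -> apred B != answer sg
}.

Record is_database (D : seq rule) : Prop := IsDatabase {
  database_fact : forall F, F \in D -> is_fact F;
  database_edb : forall F, F \in D -> ~~ idb (apred (head F))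
}.

Definition is_goal (R : rule) : bool := apred (head R) == answer sg.

Definition substitution := nat -> term.

Definition subst_term (s : substitution) (t : term) : term :=
  if t is Var x then s x else t.
Definition subst_atom (s : substitution) (A : atom) : atom :=
  Atom (apred A) (map (subst_term s) (aargs A)).
Definition subst_rule (s : substitution) (R : rule) : rule :=
  Rule (subst_atom s (head R)) (map (subst_atom s) (body R)).
Definition rename_rule (r : nat -> nat) (R : rule) : rule :=
  subst_rule (fun x => Var (r x)) R.

Definition unifier (s : substitution) (A B : atom) : Prop :=
  subst_atom s A = subst_atom s B.

(* Mgus are only determined up to renaming; wherever one is used below the
   result is normalized, so the choice is immaterial. *)
Definition mgu (s : substitution) (A B : atom) : Prop :=
  unifier s A B /\
  forall t, unifier t A B ->
    exists d : substitution, forall x, t x = subst_term d (s x).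

(* The variable x becomes X_k, where k is the number of distinct variables that
   precede the first occurrence of x. *)
Definition normalize (R : rule) : rule :=
  let vs := rule_vars R in
  rename_rule (fun x => size (undup (take (index x vs) vs))) R.

Definition renamed_apart (K R R' : rule) : Prop :=
  (exists2 r, injective r & R' = rename_rule r R) /\
  (forall x, x \in rule_vars R' -> x \notin rule_vars K).

Definition selected (R : rule) : option atom := ohead (body R).

Definition state := rule -> Prop.

Definition instance (P : seq rule) (K Q : rule) : Prop :=
  exists L R R' s,
    [/\ selected K = Some L, R \in P, renamed_apart K R R',
        mgu s L (head R') & Q = normalize (subst_rule s R')].

(* No renaming apart is needed: F has no variables. *)
Definition reduct (R F Q : rule) : Prop :=
  is_fact F /\
  exists A B Bs s,
    [/\ R = Rule A (B :: Bs), mgu s B (head F)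
      & Q = normalize (subst_rule s (Rule A Bs))].

Inductive instantiation_closure (P : seq rule) (S : state) : state :=
| InstBase Q : S Q -> instantiation_closure P S Q
| InstStep K L Q : instantiation_closure P S K ->
    selected K = Some L -> idb (apred L) -> instance P K Q ->
    instantiation_closure P S Q.

Definition initial_state (P : seq rule) : state :=
  instantiation_closure P
    (fun Q => exists G, [/\ G \in P, is_goal G & Q = normalize G]).

(* Unifiability is meant up to renaming the variables of R' apart from those of
   R: normalized rules all use the same variables X_0, X_1, ... *)
Definition depends_directly (R R' : rule) : Prop :=
  exists L R'' s,
    [/\ selected R = Some L, renamed_apart R R' R'' & unifier s L (head R'')].

Inductive depends (S : state) (R R' : rule) : Prop :=
| DependsLast : S R -> depends_directly R R' -> depends S R R'
| DependsStep R2 : S R -> depends_directly R R2 -> depends S R2 R' ->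
    depends S R R'.

(* Only rules of the old state S are reduced, first by F and then by the facts
   obtained so far.  No IDB test on those facts is needed: being derived from
   program rules, they have IDB heads. *)
Inductive reduced_state (S : state) (F : rule) : state :=
| ReduceFact R Q : S R -> reduct R F Q -> reduced_state S F Q
| ReduceAgain R G Q : S R -> reduced_state S F G -> reduct R G Q ->
    reduced_state S F Q.

Definition expanded_state (P : seq rule) (S : state) (F : rule) : state :=
  instantiation_closure P (reduced_state S F).

(* A rule of S waiting for the result of a non-fact rule of the expanded state
   is kept; the dependency chain runs inside S except for its last rule. *)
Definition next_state (P : seq rule) (S : state) (F : rule) : state :=
  fun Q => expanded_state P S F Q \/
    S Q /\ exists R', [/\ expanded_state P S F R', body R' <> [::]
                        & depends S Q R'].

Definition successor (P : seq rule) (S : state) (F : rule) (S' : state) : Prop :=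
  (exists R Q, S R /\ reduct R F Q) /\ S' = next_state P S F.

(* The sequence is S 0, ..., S n (n + 1 states). *)
Definition state_sequence (P D : seq rule) (n : nat) (S : nat -> state) : Prop :=
  forall i, i < n -> exists2 F, F \in D & successor P (S i) F (S i.+1).

Record structure := Structure {
  dom : Type;
  dom_inhabited : inhabited dom;
  const_val : const sg -> dom;
  pred_val : predsym sg -> seq dom -> Prop
}.

Definition term_val (M : structure) (v : nat -> dom M) (t : term) : dom M :=
  match t with Var x => v x | Cst c => const_val M c end.

Definition holds_atom (M : structure) (v : nat -> dom M) (A : atom) : Prop :=
  pred_val (apred A) (map (term_val v) (aargs A)).

(* Truth of the universal closure. *)
Definition holds_rule (M : structure) (R : rule) : Prop :=
  forall v : nat -> dom M,
    (forall B, B \in body R -> holds_atom v B) -> holds_atom v (head R).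

Definition logical_consequence (T : seq rule) (R : rule) : Prop :=
  forall M : structure, (forall Q, Q \in T -> holds_rule M Q) -> holds_rule M R.

Definition fact_of (A : atom) : rule := Rule A [::].

End Syntax.

Arguments term : clear implicits.
Arguments atom : clear implicits.
Arguments rule : clear implicits.
Arguments substitution : clear implicits.
Arguments state : clear implicits.
Arguments structure : clear implicits.

(* Main.v *)
(* A derivation tree of the answer is traversed from left to right, its EDB
   leaves being the facts read.  While a node is being solved, the pending part
   of the ground rule used at each of its ancestors is an instance of a rule of
   the current state.  These rules form a dependency chain ending in the rule
   under work, so clause (4) of the successor keeps them; a solved node yields
   its fact by reduction, and that fact reduces the rule of the parent within
   the same step. *)
Require Import Defs.
From mathcomp Require Import all_boot.

Set Implicit Arguments.
Unset Strict Implicit.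
Unset Printing Implicit Defensive.

Local Notation head := Defs.head.

(** * Substitutions and most general unifiers *)

Section Substitution.

Context {sg : signature}.
Implicit Types (s t d : substitution sg) (A B : atom sg) (R Q g : rule sg).

Definition subst_comp t s : substitution sg := fun x => subst_term t (s x).

Lemma subst_term_comp t s u :
  subst_term t (subst_term s u) = subst_term (subst_comp t s) u.
Proof. by case: u. Qed.

Lemma subst_atom_comp t s A :
  subst_atom t (subst_atom s A) = subst_atom (subst_comp t s) A.
Proof.
by rewrite /subst_atom /= -map_comp; congr Atom; apply: eq_map => u /=;
  rewrite subst_term_comp.
Qed.

Lemma subst_rule_comp t s R :
  subst_rule t (subst_rule s R) = subst_rule (subst_comp t s) R.
Proof.
rewrite /subst_rule /= subst_atom_comp -map_comp; congr Rule.
by apply: eq_map => B /=; rewrite subst_atom_comp.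
Qed.

Lemma eq_in_subst_atom s t A :
  {in atom_vars A, s =1 t} -> subst_atom s A = subst_atom t A.
Proof.
move=> est; rewrite /subst_atom; congr Atom; apply/eq_in_map => -[x|c] //= Ax.
by apply: est; apply/flatten_mapP; exists (Var x); rewrite ?inE.
Qed.

Lemma eq_in_subst_rule s t R :
  {in rule_vars R, s =1 t} -> subst_rule s R = subst_rule t R.
Proof.
move=> est; rewrite /subst_rule; congr Rule.
  by apply: eq_in_subst_atom => x Rx; apply: est; rewrite mem_cat Rx.
apply/eq_in_map => B RB; apply: eq_in_subst_atom => x Bx; apply: est.
by rewrite mem_cat; apply/orP; right; apply/flatten_mapP; exists B.
Qed.

Lemma subst_term_id u : subst_term (@Var sg) u = u.
Proof. by case: u. Qed.

Lemma subst_atom_id A : subst_atom (@Var sg) A = A.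
Proof. by case: A => p us; rewrite /subst_atom /= (eq_map subst_term_id) map_id. Qed.

Lemma subst_ground_atom s A : atom_vars A = [::] -> subst_atom s A = A.
Proof.
move=> A0; rewrite -[RHS]subst_atom_id.
by apply: eq_in_subst_atom => x; rewrite A0.
Qed.

Lemma atom_vars_subst s A y :
  reflect (exists2 x, x \in atom_vars A & y \in term_vars (s x))
          (y \in atom_vars (subst_atom s A)).
Proof.
apply: (iffP flatten_mapP) => [[u] /mapP[[x|c] Au ->]|[x]].
- by exists x => //; apply/flatten_mapP; exists (Var x); rewrite ?inE.
- by [].
case/flatten_mapP=> -[z|c] //= Az; rewrite inE => /eqP-> sy.
by exists (s z) => //; apply/mapP; exists (Var z).
Qed.

(* Composing with s1 fixes every unifier t of u and v, so unification can
   proceed argument by argument. *)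
Lemma unify_terms u v :
  (exists t, subst_term t u = subst_term t v) ->
  exists s1, subst_term s1 u = subst_term s1 v /\
    forall t, subst_term t u = subst_term t v -> t =1 subst_comp t s1.
Proof.
move=> [t0 tuv].
have binds x w : exists s1, s1 x = subst_term s1 w /\
    forall t, t x = subst_term t w -> t =1 subst_comp t s1.
  exists (fun y => if y == x then w else Var y); split.
    by rewrite eqxx; case: w => //= y; case: eqP => // ->.
  by move=> t txw y; rewrite /subst_comp; case: eqP => [->|].
case: u v tuv => [x|c] [y|e] /= tuv.
- exact: (binds x (Var y)).
- exact: (binds x (Cst e)).
- have [s1 [e1 H1]] := binds y (Cst c); exists s1; split=> // t te.
  exact: H1.
- by exists (@Var sg); split=> // t _ x; rewrite /subst_comp.
Qed.

(** Unify the first arguments by [s1], apply [s1] to the others and recurse on their number. A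
    unifier of the whole lists absorbs [s1], so it still unifies the others and factors through the
    composite. *)
Lemma mgu_exists t A B : unifier t A B -> exists s, mgu s A B.
Proof.
case: A B => [p us] [q vs] [-> {p}] tuv.
have [s [suv smg]]: exists s, map (subst_term s) us = map (subst_term s) vs /\
    forall t, map (subst_term t) us = map (subst_term t) vs ->
      exists d, t =1 subst_comp d s.
  have [n] := ubnP (size us).
  elim: n us vs t tuv => // n IHn [|u us] [|v vs] t //=.
    move=> _ _; exists (@Var sg); split=> // t' _.
    by exists t' => x.
  move=> [tuv tuvs] ltn.
  have [s1 [s1uv s1P]] := unify_terms (ex_intro _ t tuv).
  have absorb t' ws : subst_term t' u = subst_term t' v ->
      map (subst_term t') (map (subst_term s1) ws) = map (subst_term t') ws.
    move=> e; rewrite -map_comp; apply: eq_map => w /=.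
    by rewrite subst_term_comp; case: w => //= x; rewrite -s1P.
  have [||s2 [s2uv s2P]] := IHn (map (subst_term s1) us) (map (subst_term s1) vs) t.
  - by rewrite !absorb.
  - by rewrite size_map.
  exists (subst_comp s2 s1); split=> [|t' [e es]].
    have E ws : map (subst_term (subst_comp s2 s1)) ws =
        map (subst_term s2) (map (subst_term s1) ws).
      by rewrite -map_comp; apply: eq_map => w /=; rewrite subst_term_comp.
    by rewrite !E s2uv -!subst_term_comp s1uv.
  have [|d dP] := s2P t'; first by rewrite !absorb.
  by exists d => x; rewrite (s1P _ e) /subst_comp; case: (s1 x) => //=.
exists s; split=> [|t' [e]]; first by rewrite /unifier /subst_atom /= suv.
exact: smg.
Qed.

(** * Lifting derivation steps from instances to rules *)

Lemma rule_varsP x R :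
  reflect (x \in atom_vars (head R) \/
           exists2 B, B \in body R & x \in atom_vars B) (x \in rule_vars R).
Proof.
by rewrite mem_cat; apply: (iffP orP) => -[Hx|/flatten_mapP Bx];
  by [left|right].
Qed.

Lemma range_restrictedP R :
  reflect (forall x, x \in atom_vars (head R) ->
             exists2 B, B \in body R & x \in atom_vars B) (range_restricted R).
Proof.
by apply: (iffP allP) => rr x /rr /flatten_mapP.
Qed.

Lemma range_restricted_subst s R :
  range_restricted R -> range_restricted (subst_rule s R).
Proof.
move=> /range_restrictedP rr; apply/range_restrictedP => y.
case/atom_vars_subst=> x /rr[B RB Bx] sy; exists (subst_atom s B).
  exact: map_f.
by apply/atom_vars_subst; exists x.
Qed.

Lemma is_fact_fact_of A : is_fact (fact_of A) = (atom_vars A == [::]).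
Proof. by rewrite /is_fact /rule_vars /= cats0. Qed.

(** Links a rule [g] of the derivation tree to a rule [Q] of a state. Range restriction is carried
    along so that [Q] is a fact once its body is used up. *)
Definition generalizes Q g : Prop :=
  range_restricted Q /\ exists s, subst_rule s Q = g.

(** If [x] first occurs before [y], then [x] and all variables preceding [x] precede [y], so the
    number of [y] is larger. *)
Lemma normalize_inj R :
  let vs := rule_vars R in
  {in vs &, injective (fun x => size (undup (take (index x vs) vs)))}.
Proof.
move=> vs.
have lt_size x y : x \in vs -> y \in vs -> index x vs < index y vs ->
    size (undup (take (index x vs) vs)) < size (undup (take (index y vs) vs)).
  move=> vx vy ltxy.
  apply: (@uniq_leq_size _ (x :: undup (take (index x vs) vs))) => [|z].
    by rewrite /= undup_uniq mem_undup in_take // ltnn.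
  rewrite inE !mem_undup => /predU1P[->|]; first by rewrite in_take.
  move=> zx; have vz := mem_take zx; move: zx; rewrite !in_take // => zx.
  exact: ltn_trans ltxy.
move=> x y vx vy exy; case: (ltngtP (index x vs) (index y vs)) => [lt|lt|].
- by move: (lt_size _ _ vx vy lt); rewrite exy ltnn.
- by move: (lt_size _ _ vy vx lt); rewrite exy ltnn.
exact: index_inj.
Qed.

Lemma generalizes_normalize Q g : generalizes Q g -> generalizes (normalize Q) g.
Proof.
case=> rrQ [s <-]; split; first exact: range_restricted_subst.
rewrite /normalize; set vs := rule_vars Q; set r := fun x => size _.
(* This undoes the renaming: the first variable numbered [k] is the original one, by injectivity. *)
exists (fun k => s (nth 0 vs (find (fun x => r x == k) vs))).
rewrite subst_rule_comp; apply: eq_in_subst_rule => x vx.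
rewrite /subst_comp /=; congr s.
have hasx : has (fun y => r y == r x) vs by apply/hasP; exists x.
apply: (@normalize_inj Q) => //; last exact/eqP/(nth_find 0 hasx).
by rewrite mem_nth // -has_find.
Qed.

(** Shifting [R] by [N], a bound above the variables of [K], lets one substitution act as [t] below
    [N] and as the shifted [s] from [N] on. *)
Lemma rename_apart K R t s :
  exists R' u, [/\ renamed_apart K R R',
    subst_rule u K = subst_rule t K & subst_rule u R' = subst_rule s R].
Proof.
pose N := (\max_(x <- rule_vars K) x).+1.
have ltN x : x \in rule_vars K -> x < N.
  by move=> Kx; rewrite ltnS; apply: leq_bigmax_seq.
exists (rename_rule (addn N) R), (fun x => if x < N then t x else s (x - N)).
split; first split.
- by exists (addn N) => //; apply: addnI.
- move=> x Rx; apply/negP => /ltN; apply/negP; rewrite -leqNgt.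
  case/rule_varsP: Rx => [/atom_vars_subst[y _]|[_ /mapP[B _ ->]]].
    by rewrite inE => /eqP->; apply: leq_addr.
  by case/atom_vars_subst=> y _; rewrite inE => /eqP->; apply: leq_addr.
- by apply: eq_in_subst_rule => x /ltN ->.
rewrite subst_rule_comp; apply: eq_in_subst_rule => x _.
by rewrite /subst_comp /= ltnNge leq_addr addKn.
Qed.

Lemma generalizes_consP Q a b bs : generalizes Q (Rule a (b :: bs)) ->
  exists A B Bs s, [/\ Q = Rule A (B :: Bs), range_restricted Q,
    subst_atom s A = a, subst_atom s B = b & map (subst_atom s) Bs = bs].
Proof.
case: Q => A [|B Bs] [rr [s]] //= [<- <- <-].
by exists A, B, Bs, s.
Qed.

(** The selected atom of [Q] and the renamed head of [R] have a common instance, so they unify, and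
    the joint substitution factors through the mgu. *)
Lemma instance_generalizes P Q R a s bs :
  R \in P -> range_restricted R ->
  generalizes Q (Rule a (subst_atom s (head R) :: bs)) ->
  exists Q', instance P Q Q' /\ generalizes Q' (subst_rule s R).
Proof.
move=> PR rrR /generalizes_consP[A [B [Bs [t [-> _ _ tB _]]]]].
have [R' [u [apR uK uR]]] := rename_apart (Rule A (B :: Bs)) R t s.
have uni : unifier u B (head R').
  have uB := congr1 (fun K => nth A (body K) 0) uK.
  by have uH := congr1 head uR; rewrite /= in uB uH; rewrite /unifier uB tB uH.
have [m mg] := mgu_exists uni; have [_ /(_ _ uni) [d dP]] := mg.
exists (normalize (subst_rule m R')); split; first by exists B, R, R', m.
apply: generalizes_normalize; split.
  by case: apR => -[r _ ->] _; do 2!apply: range_restricted_subst.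
exists d; rewrite subst_rule_comp -uR.
by apply: eq_in_subst_rule => x _; rewrite dP.
Qed.

Lemma generalizes_depends Q Q' a b bs cs :
  generalizes Q (Rule a (b :: bs)) -> generalizes Q' (Rule b cs) ->
  depends_directly Q Q'.
Proof.
move=> /generalizes_consP[A [B [Bs [t [-> _ _ tB _]]]]] [_ [s sQ']].
have [R' [u [apR uK uR]]] := rename_apart (Rule A (B :: Bs)) Q' t s.
exists B, R', u; split=> //.
have uB := congr1 (fun K => nth A (body K) 0) uK.
have uH := congr1 head uR; rewrite sQ' /= in uB uH.
by rewrite /unifier uB tB uH.
Qed.

Lemma reduct_generalizes Q a b bs :
  is_fact (fact_of b) -> generalizes Q (Rule a (b :: bs)) ->
  exists Q', reduct Q (fact_of b) Q' /\ generalizes Q' (Rule a bs).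
Proof.
move=> fb /generalizes_consP[A [B [Bs [t [-> rr tA tB tBs]]]]].
move: (fb); rewrite is_fact_fact_of => /eqP b0.
have uni : unifier t B b by rewrite /unifier tB subst_ground_atom.
have [m mg] := mgu_exists uni; have [um /(_ _ uni) [d dP]] := mg.
exists (normalize (subst_rule m (Rule A Bs))); split.
  by split=> //; exists A, B, Bs, m.
apply: generalizes_normalize; split.
  (* A head variable [x] occurring in [B] is sent by [m] to a term of the ground atom [b], so [y]
     can only come from a variable of [Bs]. *)
  apply/range_restrictedP => y /atom_vars_subst[x Ax my].
  have [C] := range_restrictedP _ rr x Ax.
  rewrite inE => /predU1P[->|BsC] Cx.
    have: y \in atom_vars (subst_atom m B) by apply/atom_vars_subst; exists x.
    by rewrite um subst_ground_atom // b0.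
  exists (subst_atom m C); first exact: map_f.
  by apply/atom_vars_subst; exists x.
exists d; rewrite subst_rule_comp -tA -tBs.
by apply: (@eq_in_subst_rule _ t (Rule A Bs)) => x _; rewrite dP.
Qed.

Lemma generalizes_fact Q b :
  generalizes Q (Rule b [::]) -> Q = fact_of b /\ is_fact (fact_of b).
Proof.
case: Q => A [|B Bs] [rr [s]] //= [<-]; move/range_restrictedP: rr => rr.
have A0 : atom_vars A = [::].
  by case E: (atom_vars A) => [//|x vs]; have [|B] := rr x; rewrite //= E inE eqxx.
by rewrite subst_ground_atom // is_fact_fact_of A0.
Qed.

End Substitution.

(** * Reachable states and suspended rules *)

Section Completeness.

Context {sg : signature}.
Variables (P D : seq (rule sg)) (hP : is_program P) (hD : is_database D).
Implicit Types (S : state sg) (F Q R : rule sg) (a b : atom sg).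

Inductive reachable : state sg -> Prop :=
| ReachInit : reachable (initial_state P)
| ReachStep S F S' : reachable S -> F \in D -> successor P S F S' -> reachable S'.

Lemma reachableP S : reachable S ->
  exists n Sq, [/\ Sq 0 = initial_state P, state_sequence P D n Sq & Sq n = S].
Proof.
elim=> {S} [|S F S' _ [n [Sq [Sq0 Sqn <-]]] DF succF].
  by exists 0, (fun=> initial_state P).
exists n.+1, (fun i => if i <= n then Sq i else S'); rewrite ltnn; split=> // i.
rewrite ltnS /= => le_in; rewrite le_in.
move: le_in; rewrite leq_eqVlt => /predU1P[->|lt_in].
  by rewrite ltnn; exists F.
by rewrite lt_in; apply: Sqn.
Qed.

(* The stack st lists the suspended ground rules, innermost first: a is the
   selected atom of the first one, whose head is selected in the second, etc. *)
Fixpoint awaited S a (st : seq (rule sg)) : Prop :=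
  if st is g :: st' then
    [/\ exists bs, body g = a :: bs, exists2 Q, S Q & generalizes Q g
      & awaited S (head g) st']
  else True.

Lemma depends_rcons S Q R R' :
  depends S Q R -> S R -> depends_directly R R' -> depends S Q R'.
Proof.
move=> dQ SR dRR'; elim: dQ SR dRR' => {Q R} [Q R|Q R R2] SQ dQ.
  by move=> SR dR; apply: DependsStep dQ _ => //; apply: DependsLast.
by move=> _ IH SR2 dR2; apply: DependsStep dQ _ => //; apply: IH.
Qed.

(** Each suspended rule depends on [Q] through the rules inside it on the stack, so keeping the
    dependents of [Q] keeps the whole stack. *)
Lemma awaited_depends S S' st a cs Q :
  generalizes Q (Rule a cs) -> (forall R, depends S R Q -> S' R) ->
  awaited S a st -> awaited S' a st.
Proof.
elim: st a cs Q => //= g st IHst a cs Q gQ sub [[bs gbs] [R SR gR] aw].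
have gR' : generalizes R (Rule (head g) (a :: bs)).
  by rewrite -gbs; case: g gR {aw gbs}.
have dR : depends_directly R Q by apply: generalizes_depends gR' gQ.
split; first by exists bs.
  by exists R => //; apply: sub; apply: DependsLast.
by apply: (IHst _ _ _ gR') => // R2 dR2; apply: sub; apply: depends_rcons dR2 _ _.
Qed.

(** The seed [T] is recorded because instantiation acts only on the new part of a state, not on the
    copied rules. *)
Definition ready a bs st : Prop :=
  exists S T Q, [/\ reachable S, forall R, instantiation_closure P T R -> S R,
    instantiation_closure P T Q, generalizes Q (Rule a bs) & awaited S a st].

(** A situation inside a step: [Q] is a reduct by [F], while the stack still lies in the old state,
    whose rules clause (2) may reduce. *)
Definition solved a bs st : Prop :=
  exists S F Q, [/\ reachable S, F \in D, reduced_state S F Q,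
    generalizes Q (Rule a bs) & awaited S a st].

Lemma reduced_state_successor S F Q :
  reduced_state S F Q -> successor P S F (next_state P S F).
Proof. by move=> rQ; split=> //; elim: rQ => // R Q' SR red; exists R, Q'. Qed.

(** Completes the step: as a literal remains in [Q], clause (4) copies the stack. *)
Lemma solved_ready a b bs st : solved a (b :: bs) st -> ready a (b :: bs) st.
Proof.
move=> [S [F [Q [rS DF rQ gQ aw]]]].
have eQ : expanded_state P S F Q by apply: InstBase.
exists (next_state P S F), (reduced_state S F), Q; split=> //.
- exact: ReachStep rS DF (reduced_state_successor rQ).
- by move=> R; left.
apply: (awaited_depends gQ _ aw) => R dR; right; split; first by case: dR.
by exists Q; split=> //; case: gQ => _ [s]; case: (Q) => H [].
Qed.

(** The quantification over all stacks lets the induction on derivations push a rule. *)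
Definition solvable b : Prop :=
  forall a bs st, ready a (b :: bs) st -> solved a bs st.

(** Literals are solved from left to right. The step is completed after each one except the last,
    whose result is still usable within the same step. *)
Lemma ready_solved_body a bs st : bs != [::] ->
  {in bs, forall b, solvable b} -> ready a bs st -> solved a [::] st.
Proof.
elim: bs => // b [|c bs] IHbs _ solv /(solv b (mem_head _ _)) // sol.
apply: IHbs (solved_ready sol) => // d bsd; apply: solv.
by rewrite inE bsd orbT.
Qed.

(** * Derivations, the induction on them, and the term model *)

Inductive derivable : atom sg -> Prop :=
| Derive R s : R \in P ++ D ->
    (forall B, B \in body R -> derivable (subst_atom s B)) ->
    derivable (subst_atom s (head R)).

Lemma body_subst_neq0 R (s : substitution sg) :
  R \in P -> map (subst_atom s) (body R) != [::].
Proof. by move/(program_body hP); case: (body R). Qed.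

Lemma derivable_solvable b : derivable b -> solvable b.
Proof.
elim=> {b} R s PDR _ IHR a bs st [S [T [Q [rS TS TQ gQ aw]]]].
move: PDR; rewrite mem_cat => /orP[PR|DR]; last first.
  (* A database leaf: [R] itself is the fact read next. *)
  have fR := database_fact hD DR; have [/eqP R0 _] := andP fR.
  have eR : R = fact_of (head R) by case: (R) R0 => H B /= ->.
  have /eqP H0 : atom_vars (head R) == [::] by rewrite -is_fact_fact_of -eR.
  rewrite subst_ground_atom // in gQ.
  have [|Q' [red gQ']] := reduct_generalizes _ gQ; first by rewrite -eR.
  exists S, R, Q'; split=> //; apply: ReduceFact (TS _ TQ) _.
  by rewrite [in reduct _ R _]eR.
(* An inner node: suspend [g] and solve the body of [R], starting from an instance of [Q] in the
   same closure. *)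
pose g := Rule a (subst_atom s (head R) :: bs).
have [Q' [inst gQ']] := instance_generalizes PR (program_range_restricted hP PR) gQ.
have: ready (subst_atom s (head R)) (map (subst_atom s) (body R)) (g :: st).
  exists S, T, Q'; split=> //; last first.
    by split=> //; [exists bs | exists Q => //; apply: TS].
  have [A [B [Bs [t [eQ _ _ tB _]]]]] := generalizes_consP gQ.
  apply: (InstStep (K := Q) (L := B)) => //; first by rewrite eQ.
  by have := program_head_idb hP PR; rewrite -[apred B]/(apred (subst_atom t B)) tB.
move/(ready_solved_body (body_subst_neq0 s PR)).
case=> [_ /mapP[B RB ->]|S1 [F [G [rS1 DF rG gG [_ [Q1 SQ1 gQ1] aw1]]]]].
  exact: IHR.
(* The fact obtained for the node reduces the suspended parent [Q1] in the same step. *)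
have [eG fG] := generalizes_fact gG; rewrite eG in rG.
have [Q2 [red gQ2]] := reduct_generalizes fG gQ1.
by exists S1, F, Q2; split=> //; apply: ReduceAgain SQ1 rG red.
Qed.

(* Variables serve as extra domain elements, so that the domain is inhabited
   even without constants. *)
Definition derivable_structure : structure sg :=
  Structure (inhabits (@Var sg 0)) (@Cst sg) (fun p us => derivable (Atom p us)).

Lemma holds_derivable (v : substitution sg) a :
  @holds_atom sg derivable_structure v a = derivable (subst_atom v a).
Proof.
by rewrite /holds_atom /=; congr (derivable (Atom _ _)); apply: eq_map; case.
Qed.

(** The structure of derivable atoms is a model of [P ++ D]; the identity valuation gives back
    [a]. *)
Lemma consequence_derivable a :
  logical_consequence (P ++ D) (fact_of a) -> derivable a.
Proof.
move/(_ derivable_structure) => cons; rewrite -[a]subst_atom_id -holds_derivable.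
apply: cons => [R PDR v hB|//]; rewrite holds_derivable; apply: Derive => // B RB.
by rewrite -holds_derivable; apply: hB.
Qed.

Lemma derivable_answer a : apred a = answer sg -> derivable a ->
  exists n Sq, [/\ Sq 0 = initial_state P, state_sequence P D n Sq
                 & Sq n (fact_of a)].
Proof.
move=> ea da; case: da ea => R s PDR hB eR.
(* [answer] is IDB, so the last rule applied is a goal rule, and the traversal starts in the initial
   state with an empty stack. *)
have PR : R \in P.
  move: PDR; rewrite mem_cat => /orP[//|/(database_edb hD)].
  by rewrite [apred _]eR answer_idb.
have: ready (subst_atom s (head R)) (map (subst_atom s) (body R)) [::].
  have goalR : initial_state P (normalize R).
    by apply: InstBase; exists R; rewrite /is_goal [apred _]eR.
  do 2!eexists; exists (normalize R); split; [exact: ReachInit| |exact: goalR| |] => //.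
  by apply: generalizes_normalize; split; [apply: (program_range_restricted hP)|exists s].
move/(ready_solved_body (body_subst_neq0 s PR)).
case=> [_ /mapP[B RB ->]|S [F [G [rS DF rG gG _]]]].
  by apply: derivable_solvable; apply: hB.
have [eG _] := generalizes_fact gG.
have /reachableP[n [Sq [Sq0 Sqn eS]]] :=
  ReachStep rS DF (reduced_state_successor rG).
by exists n, Sq; split=> //; rewrite eS; left; apply: InstBase; rewrite -eG.
Qed.

End Completeness.

Theorem theorem2 (sg : signature) (P D : seq (rule sg))
    (hP : is_program P) (hD : is_database D)
    (xs : seq nat) (Bs : seq (atom sg))
    (hgoal : Rule (Atom (answer sg) (map Var xs)) Bs \in P)
    (theta : substitution sg)
    (hground : forall x, x \in xs -> is_const (theta x))
    (hcons : logical_consequence (P ++ D)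
               (fact_of (subst_atom theta (Atom (answer sg) (map Var xs))))) :
  exists (n : nat) (S : nat -> state sg),
    [/\ S 0 = initial_state P, state_sequence P D n S
      & S n (fact_of (subst_atom theta (Atom (answer sg) (map Var xs))))].
Proof.
exact: (derivable_answer hP hD) (consequence_derivable hcons).
Qed.
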